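(* Let $(x^k,y^k)$ be a sequence generated by the primal-dual algorithm with linesearch (PDAL) described in the context, and let $(\hat x,\hat y)$ be any saddle point of $\min_{x\in X}\max_{y\in Y}\langle Kx,y\rangle+g(x)-f^*(y)$. For $N\ge1$ define $$s_N=\sum_{k=1}^N\tau_k,\qquad X^N=\frac{\tau_1\theta_1x^0+\sum_{k=1}^N\tau_k\bar x^k}{\tau_1\theta_1+s_N},\qquad Y^N=\frac{\sum_{k=1}^N\tau_ky^{k+1}}{s_N}.$$ Then $$\mathcal G_{\hat x,\hat y}(X^N,Y^N)\le\frac1{s_N}\left(\frac12\|x^1-\hat x\|^2+\frac1{2\beta}\|y^1-\hat y\|^2+\tau_1\theta_1P_{\hat x,\hat y}(x^0)\right).$$
   Context: Setting: $X,Y$ are finite-dimensional real inner product spaces with norms $\|\cdot\|=\sqrt{\langle\cdot,\cdot\rangle}$; $K\colon X\to Y$ is linear with adjoint $K^*$; $g\colon X\to(-\infty,+\infty]$ and $f^*\colon Y\to(-\infty,+\infty]$ are proper lower semicontinuous convex functions ($f^*$ is the Legendre–Fenchel conjugate of a convex lower semicontinuous function $f$). For a pair $(\hat x,\hat y)\in \operatorname{dom} g\times\operatorname{dom} f^*$ put $P_{\hat x,\hat y}(x)=g(x)-g(\hat x)+\langle K^*\hat y,x-\hat x\rangle$, $D_{\hat x,\hat y}(y)=f^*(y)-f^*(\hat y)-\langle K\hat x,y-\hat y\rangle$, and $\mathcal G_{\hat x,\hat y}(x,y)=P_{\hat x,\hat y}(x)+D_{\hat x,\hat y}(y)$ (primal-dual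 gap). The pair is a saddle point if $P_{\hat x,\hat y}\ge0$ on $X$ and $D_{\hat x,\hat y}\ge0$ on $Y$. It is assumed that a saddle point exists. $\operatorname{prox}_h(x)=\operatorname{argmin}_z\{h(z)+\frac12\|z-x\|^2\}$. PDAL. Initialization: choose $x^0\in X$, $y^1\in Y$, $\tau_0>0$, $\mu\in(0,1)$, $\delta\in(0,1)$, $\beta>0$; set $\theta_0=1$. For $k=1,2,\dots$: 1. $x^k=\operatorname{prox}_{\tau_{k-1}g}(x^{k-1}-\tau_{k-1}K^*y^k)$. 2. Choose any trial value $\tau_k\in[\tau_{k-1},\tau_{k-1}\sqrt{1+\theta_{k-1}}]$ and run the linesearch: 2.a. compute $\theta_k=\tau_k/\tau_{k-1}$, $\bar x^k=x^k+\theta_k(x^k-x^{k-1})$, $y^{k+1}=\operatorname{prox}_{\beta\tau_kf^*}(y^k+\beta\tau_kK\bar x^k)$; 2.b. if $\sqrt\beta\,\tau_k\|K^*y^{k+1}-K^*y^k\|\le\delta\|y^{k+1}-y^k\|$, stop the linesearch (keeping the current $\tau_k,\theta_k,\bar x^k,y^{k+1}$); otherwise replace $\tau_k$ by $\mu\tau_k$ and return to 2.a. *)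

(* Defs.v *)
From HB Require Import structures.
From mathcomp Require Import all_boot all_order all_algebra.
From mathcomp Require Import all_classical all_reals all_analysis.

Set Implicit Arguments.
Unset Strict Implicit.
Unset Printing Implicit Defensive.

Import Order.TTheory GRing.Theory Num.Theory.
Import numFieldNormedType.Exports.

Local Open Scope classical_set_scope.
Local Open Scope ring_scope.

(* Finite-dimensional real inner product spaces; [`|x|] and the topology are
   the ones induced by the inner product. *)
HB.mixin Record NormedVector_isEuclidean (R : realType) V
    of NormedModule R V & Vector R V := {
  inner : {dot V for @idfun R} ;
  normE_inner : forall x : V, `|x| = Num.sqrt (inner x x) }.

#[short(type="euclideanType")]
HB.structure Definition Euclidean (R : realType) :=
  {V of NormedModule R V & Vector R V & NormedVector_isEuclidean R V}.

Notation "'<< x , y >>" := (inner x y)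
  (at level 0, x at level 99, y at level 99, format "''<<' x ,  y '>>'")
  : ring_scope.

Section ConvexAnalysis.
Context {R : realType} {V : euclideanType R}.
Implicit Types (h : V -> \bar R) (x z : V).

Local Open Scope ereal_scope.

Definition dom h : set V := [set x | h x < +oo].

Definition proper_efun h := (forall x, h x != -oo) /\ dom h !=set0.

Definition econvex h := forall x z (t : R), (0 <= t <= 1)%R ->
  h (t *: x + (1 - t) *: z)%R <= t%:E * h x + (1 - t)%:E * h z.

Definition conjugate h : V -> \bar R :=
  fun y => ereal_sup (range (fun x => ('<<x, y>>)%:E - h x)).

Definition argmin h : set V := [set z | forall w, h z <= h w].

Definition prox h x : set V :=
  argmin (fun z => h z + (2^-1 * `|z - x| ^+ 2)%:E).

End ConvexAnalysis.

Section PrimalDual.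
Context {R : realType} {X Y : euclideanType R}.
Variables (K : {linear X -> Y}) (Kstar : {linear Y -> X}).

Definition adjoint := forall x y, '<<K x, y>> = '<<x, Kstar y>>.

(* [fs] stands for f^*. *)
Variables (g : X -> \bar R) (fs : Y -> \bar R).

Section Gap.
Variables (xh : X) (yh : Y).
Local Open Scope ereal_scope.

Definition Pgap (x : X) : \bar R := g x - g xh + ('<<Kstar yh, x - xh>>)%:E.

Definition Dgap (y : Y) : \bar R := fs y - fs yh - ('<<K xh, y - yh>>)%:E.

Definition pdgap (x : X) (y : Y) : \bar R := Pgap x + Dgap y.

Definition saddle_point :=
  [/\ dom g xh, dom fs yh,
      forall x, 0 <= Pgap x & forall y, 0 <= Dgap y].

End Gap.

Variables (mu delta beta : R).

Section Linesearch.
(* [xp], [x], [y], [taup] are x^(k-1), x^k, y^k, tau_(k-1). *)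
Variables (xp x : X) (y : Y) (taup : R).

Definition ls_theta (t : R) : R := t / taup.

Definition ls_xbar (t : R) : X := x + ls_theta t *: (x - xp).

Definition ls_dual (t : R) : set Y :=
  prox (fun z => (beta * t)%:E * fs z)%E (y + (beta * t) *: K (ls_xbar t)).

Definition ls_accept (t : R) (y' : Y) : bool :=
  Num.sqrt beta * t * `|Kstar y' - Kstar y| <= delta * `|y' - y|.

(* [linesearch t tau theta xbar y']: the loop entered with the trial value [t]
   terminates, keeping the step [tau], the ratio [theta] and the points [xbar]
   and [y'] (the next dual iterate). *)
Inductive linesearch (t : R) : R -> R -> X -> Y -> Prop :=
| ls_stop y' : ls_dual t y' -> ls_accept t y' ->
    linesearch t t (ls_theta t) (ls_xbar t) y'
| ls_retry yt tau theta xbar y' : ls_dual t yt -> ~~ ls_accept t yt ->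
    linesearch (mu * t) tau theta xbar y' ->
    linesearch t tau theta xbar y'.

End Linesearch.

(* The algorithm uses neither [y 0] nor [xbar 0]. *)
Record pdal (x : nat -> X) (y : nat -> Y) (tau theta : nat -> R)
    (xbar : nat -> X) : Prop := {
  pdal_mu : 0 < mu < 1 ;
  pdal_delta : 0 < delta < 1 ;
  pdal_beta : 0 < beta ;
  pdal_tau0 : 0 < tau 0%N ;
  pdal_theta0 : theta 0%N = 1 ;
  pdal_primal : forall k,
    prox (fun z => (tau k)%:E * g z)%E (x k - tau k *: Kstar (y k.+1))
      (x k.+1) ;
  pdal_linesearch : forall k, exists2 t,
    tau k <= t <= tau k * Num.sqrt (1 + theta k) &
    linesearch (x k) (x k.+1) (y k.+1) (tau k)
      t (tau k.+1) (theta k.+1) (xbar k.+1) (y k.+2) }.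

End PrimalDual.

Section Ergodic.
Context {R : realType} {X Y : euclideanType R}.
Variables (x : nat -> X) (y : nat -> Y) (tau theta : nat -> R)
  (xbar : nat -> X).

Definition tau_sum (N : nat) : R := \sum_(1 <= k < N.+1) tau k.

Definition x_avg (N : nat) : X :=
  (tau 1%N * theta 1%N + tau_sum N)^-1 *:
    ((tau 1%N * theta 1%N) *: x 0%N + \sum_(1 <= k < N.+1) tau k *: xbar k).

Definition y_avg (N : nat) : Y :=
  (tau_sum N)^-1 *: \sum_(1 <= k < N.+1) tau k *: y k.+1.

End Ergodic.

(* Main.v *)
Require Import Defs.
From HB Require Import structures.
From mathcomp Require Import all_boot all_order all_algebra.
From mathcomp Require Import all_classical all_reals all_analysis.
From mathcomp Require Import ring lra.
Import Order.TTheory GRing.Theory Num.Theory.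
Import numFieldNormedType.Exports.
Local Open Scope classical_set_scope.
Local Open Scope ring_scope.

(* The variational inequalities of the proximal steps, taken at the saddle
   point and, for the primal step, also at the two neighbouring iterates,
   combine into a decrease of
     [E k = 1/2 |x k - xh|^2 + 1/(2 beta) |y k - yh|^2]:
     [tau k ((1 + theta k) P(x k) - theta k P(x (k-1)) + D(y (k+1)))
        <= E k - E (k+1)].
   Summing, the coefficient of [P(x k)] becomes
   [tau k (1 + theta k) - tau (k+1) theta (k+1)], nonnegative because
   [tau (k+1) <= tau k sqrt (1 + theta k)]. [x_avg] is the convex combination of
   [x 1, .., x N] with exactly these weights: [x 0] cancels against the
   extrapolations [xbar k], so Jensen's inequality gives the bound. If
   [g (x 0) = +oo] the right-hand side is infinite. *)

Set Implicit Arguments.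
Unset Strict Implicit.
Unset Printing Implicit Defensive.

(** * Algebra of the real inner product *)

Section InnerProduct.
Context (R : realType) (V : euclideanType R).
Implicit Types u v w : V.

Lemma innerC u v : '<<u, v>> = '<<v, u>>.
Proof. by rewrite hermC /= expr0 mul1r. Qed.

Lemma innerDl u v w : '<<u + v, w>> = '<<u, w>> + '<<v, w>>.
Proof. exact: linearDl. Qed.

Lemma innerZl a u v : '<<a *: u, v>> = a * '<<u, v>>.
Proof. exact: linearZl_LR. Qed.

Lemma innerNl u v : '<<- u, v>> = - '<<u, v>>.
Proof. by rewrite -scaleN1r innerZl mulN1r. Qed.

Lemma innerDr u v w : '<<u, v + w>> = '<<u, v>> + '<<u, w>>.
Proof. by rewrite innerC innerDl !(innerC _ u). Qed.

Lemma innerZr a u v : '<<u, a *: v>> = a * '<<u, v>>.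
Proof. by rewrite innerC innerZl innerC. Qed.

Lemma innerNr u v : '<<u, - v>> = - '<<u, v>>.
Proof. by rewrite innerC innerNl innerC. Qed.

Lemma inner_ge0 u : 0 <= '<<u, u>>.
Proof.
have [->|u0] := eqVneq u 0.
  by rewrite -[X in '<<X, _>>](scale0r 0) innerZl mul0r.
exact/ltW/neq0_dnorm_gt0.
Qed.

Lemma sqr_normE u : `|u| ^+ 2 = '<<u, u>>.
Proof. by rewrite normE_inner sqr_sqrtr// inner_ge0. Qed.

End InnerProduct.

Definition innerE := (innerDl, innerDr, innerNl, innerNr, innerZl, innerZr).

(** * Jensen's inequality and proximal points of extended-valued convex functions *)

Section ConvexFunctions.
Context (R : realType) (V : euclideanType R).
Implicit Types (h : V -> \bar R) (u v w : V).

Lemma econvexD_affine h (a : V -> R) :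
  econvex h ->
  (forall u v t, a (t *: u + (1 - t) *: v) = t * a u + (1 - t) * a v) ->
  econvex (fun v => h v + (a v)%:E)%E.
Proof.
move=> ch aff u v t t01; rewrite aff EFinD.
rewrite !muleDr ?fin_num_adde_defl// -!EFinM addeACA.
by rewrite -EFinD leeD2r// ch.
Qed.

(** Real majorants [r i] of the values keep the right-hand side in [R]. The induction splits off one
    point by two-point convexity. *)
Lemma jensen h (I : Type) (s : seq I) (c : I -> R) (u : I -> V) (r : I -> R) :
  econvex h -> (forall i, 0 <= c i) -> (forall i, (h (u i) <= (r i)%:E)%E) ->
  0 < \sum_(i <- s) c i ->
  (h ((\sum_(i <- s) c i)^-1 *: \sum_(i <- s) c i *: u i)
    <= ((\sum_(i <- s) c i)^-1 * \sum_(i <- s) c i * r i)%:E)%E.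
Proof.
move=> ch c0 hr.
(* Weights may vanish, so the induction carries an alternative: a tail of total weight zero, which
   cannot be normalised, contributes nothing to the three sums. *)
suff: [/\ \sum_(i <- s) c i = 0, \sum_(i <- s) c i *: u i = 0
        & \sum_(i <- s) c i * r i = 0] \/
  0 < \sum_(i <- s) c i /\
  (h ((\sum_(i <- s) c i)^-1 *: \sum_(i <- s) c i *: u i)
    <= ((\sum_(i <- s) c i)^-1 * \sum_(i <- s) c i * r i)%:E)%E.
  by case=> [[-> _ _]|[]]; rewrite ?ltxx.
elim: s => [|i s IH]; first by left; rewrite !big_nil.
rewrite !big_cons.
move: IH; set S := \sum_(j <- s) c j; set U := \sum_(j <- s) c j *: u j.
set Q := \sum_(j <- s) c j * r j => IH.
have [ci0|ci] := eqVneq (c i) 0; first by rewrite ci0 scale0r mul0r !add0r.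
have {}ci : 0 < c i by rewrite lt_neqAle eq_sym ci c0.
right; case: IH => [[-> -> ->]|[S0 IH]].
  by rewrite !addr0 scalerA mulVf ?gt_eqF// scale1r mulrA mulVf ?gt_eqF// mul1r.
have cS : 0 < c i + S by exact: addr_gt0.
split=> //.
set t := c i / (c i + S).
have t1 : 1 - t = S / (c i + S) by rewrite /t; field; rewrite gt_eqF.
have t01 : 0 <= t <= 1.
  by rewrite divr_ge0 ?(ltW ci) ?(ltW cS)//= ler_pdivrMr// mul1r lerDl ltW.
have -> : (c i + S)^-1 *: (c i *: u i + U) = t *: u i + (1 - t) *: (S^-1 *: U).
  rewrite t1 scalerA scalerDr scalerA /t; congr (_ *: _ + _ *: _).
    by rewrite mulrC.
  by field; rewrite !gt_eqF.
apply: (le_trans (ch _ _ _ t01)).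
have -> : ((c i + S)^-1 * (c i * r i + Q))%:E =
    (t%:E * (r i)%:E + (1 - t)%:E * (S^-1 * Q)%:E)%E.
  rewrite -!EFinM -EFinD t1 /t; congr (_%:E).
  by field; rewrite !gt_eqF.
case/andP: t01 => t0 t1'.
by apply: leeD; apply: lee_wpmul2l; rewrite ?lee_fin ?subr_ge0.
Qed.

Lemma fin_num_proper_dom h v : proper_efun h -> dom h v -> h v \is a fin_num.
Proof. by move=> [hN _] hv; rewrite fin_numElt hv andbT ltNye. Qed.

(** Compared with any point of the domain, a minimiser cannot have the value [+oo]. *)
Lemma prox_fin_num h (t : R) v p : 0 < t -> proper_efun h ->
  prox (fun z => t%:E * h z)%E v p -> h p \is a fin_num.
Proof.
move=> t0 ph hp; apply: fin_num_proper_dom => //.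
case: (ph) => hN [w hw].
have /fineK hwE := fin_num_proper_dom ph hw.
rewrite /dom /= ltey; apply/eqP => hpE.
have := hp w; rewrite hpE gt0_muley ?lte_fin// -hwE -EFinM -EFinD addye//.
Qed.

(** Minimality of [p] is tested against [p + s *: (w - p)]; convexity bounds [h] there, and after
    division by [s] the limit [s -> 0] gives the inequality. *)
Lemma prox_variational h (t : R) v p w : 0 < t -> proper_efun h ->
  econvex h -> prox (fun z => t%:E * h z)%E v p -> h w \is a fin_num ->
  t * (fine (h p) - fine (h w)) <= '<<p - v, w - p>>.
Proof.
move=> t0 ph ch hp hw; have := prox_fin_num t0 ph hp.
move=> /fineK; move: hw => /fineK.
set hw := fine (h w); set hpp := fine (h p) => hwE hpE.
have key s : 0 < s <= 1 ->
    t * (hpp - hw) <= '<<p - v, w - p>> + s / 2 * `|w - p| ^+ 2.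
  move=> /andP[s0 s1].
  have := ch w p s; rewrite (ltW s0) s1 => /(_ isT).
  have := hp (s *: w + (1 - s) *: p).
  rewrite -hwE -hpE -!EFinM -!EFinD.
  have -> : s *: w + (1 - s) *: p = p + s *: (w - p).
    by rewrite scalerBl scalerBr scale1r addrCA.
  move=> h1 h2.
  have h3 : (t%:E * h (p + s *: (w - p))%R + (2^-1 * `|p + s *: (w - p) - v| ^+ 2)%:E
      <= (t * (s * hw + (1 - s) * hpp) + 2^-1 * `|p + s *: (w - p) - v| ^+ 2)%:E)%E.
    by rewrite [leRHS]EFinD leeD2r// [leRHS]EFinM lee_pmul2l.
  have := le_trans h1 h3; rewrite lee_fin.
  have -> : p + s *: (w - p) - v = (p - v) + s *: (w - p) by rewrite addrAC.
  rewrite !sqr_normE.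
  move: (p - v) (w - p) => a b; rewrite !innerE (innerC b a) => h4.
  rewrite -(ler_pM2l s0); lra.
apply/ler_addgt0Pr => e e0.
set n2 := `|w - p| ^+ 2 in key.
have n0 : 0 <= n2 by exact: sqr_ge0.
(* This choice gives [s * (n2 + 1) <= e], hence an error term below [e]; the [+ 1] avoids dividing
   by zero when [w = p]. *)
set s := Num.min 1 (e / (n2 + 1)).
have n1 : 0 < n2 + 1 by lra.
have s0 : 0 < s by rewrite lt_min ltr01 divr_gt0.
have := key s; rewrite s0 ge_min lexx => /(_ isT) /le_trans; apply.
rewrite lerD2l.
have : s * (n2 + 1) <= e by rewrite -ler_pdivlMr// ge_min lexx orbT.
nra.
Qed.

End ConvexFunctions.

(** * Outcome of the linesearch and the one-step energy estimate *)

Section PrimalDualLinesearch.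
Context (R : realType) (X Y : euclideanType R).
Context (K : {linear X -> Y}) (Kstar : {linear Y -> X}).
Context (g : X -> \bar R) (fs : Y -> \bar R) (mu delta beta : R).
Hypothesis KKstar : adjoint K Kstar.

(** Induction on the retries: each one multiplies the trial value by [mu], which lies in
    [(0, 1)]. *)
Lemma linesearchP (xp x : X) (y : Y) (taup t tau theta : R) xbar y' :
  0 < mu < 1 -> 0 < t ->
  linesearch K Kstar fs mu delta beta xp x y taup t tau theta xbar y' ->
  [/\ 0 < tau <= t, theta = tau / taup, xbar = x + theta *: (x - xp),
      ls_dual K fs beta xp x y taup tau y' &
      ls_accept Kstar delta beta y tau y'].
Proof.
move=> /andP[mu0 mu1] t0 ls.
elim: ls t0 => {t tau theta xbar y'}
  [t y' d a t0|t yt tau theta xbar y' _ _ _ IH t0].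
  by rewrite t0 lexx.
have [/andP[tau0 le_tau] -> -> d a] := IH (mulr_gt0 mu0 t0).
by split=> //; rewrite tau0 (le_trans le_tau)// ger_pMl// ltW.
Qed.

(* [q], [p], [p'] stand for [x (k-1)], [x k], [x k.+1] and [y], [y'] for [y k],
   [y k.+1]. After summation the coupling term is
   [tau * <K^*(y' - y), pb - p'>]; instead of Cauchy-Schwarz and Young, it is
   absorbed by expanding [0 <= `|(pb - p') - tau *: K^*(y' - y)| ^+ 2], the
   acceptance test controlling the remaining [tau ^+ 2 * `|K^*(y' - y)| ^+ 2]. *)
Lemma energy_step (tau theta gp gp' gq gh f' fh : R) (p p' q xh : X)
    (y y' yh : Y) (pb := p + theta *: (p - q)) :
  0 < beta ->
  tau * (gp' - gh) <= '<<p' - (p - tau *: Kstar y'), xh - p'>> ->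
  tau * (gp - gp') <= '<<theta *: (p - q) + tau *: Kstar y, p' - p>> ->
  tau * theta * (gp - gq) <=
    '<<theta *: (p - q) + tau *: Kstar y, theta *: (q - p)>> ->
  beta * tau * (f' - fh) <=
    '<<y' - (y + (beta * tau) *: K pb), yh - y'>> ->
  beta * (tau ^+ 2 * `|Kstar y' - Kstar y| ^+ 2) <= `|y' - y| ^+ 2 ->
  tau * ((1 + theta) * (gp - gh + '<<Kstar yh, p - xh>>)
         - theta * (gq - gh + '<<Kstar yh, q - xh>>)
         + (f' - fh - '<<K xh, y' - yh>>))
  <= 2^-1 * `|p - xh| ^+ 2 + (2 * beta)^-1 * `|y - yh| ^+ 2
     - (2^-1 * `|p' - xh| ^+ 2 + (2 * beta)^-1 * `|y' - yh| ^+ 2).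
Proof.
move=> beta0 Ip' Ip Iq Iy acc.
have sq0 := inner_ge0 ((pb - p') - tau *: (Kstar y' - Kstar y)).
(* The primal inequalities leave [- 1/2 |pb - p'|^2 - 1/2 |theta *: (p - q)|^2]: the first square
   absorbs the coupling, the second is dropped by its sign. *)
have sq1 := inner_ge0 (theta *: (p - q)).
move: Iy acc; rewrite !sqr_normE.
set ib := (2 * beta)^-1.
have ibE : beta * ib = 2^-1 by rewrite /ib; field; rewrite gt_eqF.
have ib0 : 0 < ib by rewrite invr_gt0; lra.
move=> /(ler_wpM2l (ltW ib0)) Iy /(ler_wpM2l (ltW ib0)) acc.
have {}Iy : tau * (f' - fh) <=
    2 * ib * '<<y' - y, yh - y'>> - tau * '<<pb, Kstar yh - Kstar y'>>.
  have -> : '<<pb, Kstar yh - Kstar y'>> = '<<K pb, yh - y'>>.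
    by rewrite KKstar (linearB Kstar).
  have e : '<<y' - (y + (beta * tau) *: K pb), yh - y'>> =
      '<<y' - y, yh - y'>> - beta * tau * '<<K pb, yh - y'>>.
    by rewrite opprD addrA (innerDl (y' - y)) innerNl innerZl.
  rewrite e {e} in Iy.
  have e1 : ib * (beta * tau * (f' - fh)) = 2^-1 * (tau * (f' - fh)).
    by rewrite -ibE; ring.
  have e2 z : ib * (beta * tau * z) = 2^-1 * (tau * z).
    by rewrite -ibE; ring.
  by move: Iy; rewrite e1 (mulrBr ib) e2; lra.
have {}acc : tau ^+ 2 * '<<Kstar y' - Kstar y, Kstar y' - Kstar y>> <=
    2 * ib * '<<y' - y, y' - y>>.
  have e z : ib * (beta * z) = 2^-1 * z by rewrite -ibE; ring.
  by move: acc; rewrite e; lra.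
have -> : '<<K xh, y' - yh>> = '<<xh, Kstar y' - Kstar yh>>.
  by rewrite KKstar (linearB Kstar).
rewrite /pb {pb} in sq0 Iy *.
(* Three-point identity, which produces the dual distances of the energy. *)
have Y2 : '<<y' - y, yh - y'>> =
    2^-1 * ('<<y - yh, y - yh>> - '<<y' - yh, y' - yh>> - '<<y' - y, y' - y>>).
  rewrite !innerE (innerC yh y) (innerC yh y') (innerC y' y).
  by field.
move: Y2 Iy acc.
set A := '<<y' - y, yh - y'>>; set B := '<<y - yh, y - yh>>.
set C := '<<y' - yh, y' - yh>>; set D := '<<y' - y, y' - y>> => -> Iy acc.
have {}Iy : tau * (f' - fh) <= ib * B - ib * C - ib * D
    - tau * '<<p + theta *: (p - q), Kstar yh - Kstar y'>> by lra.
have {}acc : tau ^+ 2 * '<<Kstar y' - Kstar y, Kstar y' - Kstar y>> <=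
    2 * (ib * D) by lra.
(* With these products abstracted and every inner product expanded and oriented one way, the claim
   is a linear combination of the hypotheses. *)
move: (ib * B) (ib * C) (ib * D) Iy acc => {}B {}C {}D.
move: (Kstar y) (Kstar y') (Kstar yh) Ip' Ip Iq sq0 sq1 => a b c.
rewrite !innerE.
rewrite ?(innerC p' p) ?(innerC q p) ?(innerC q p')
  ?(innerC xh p) ?(innerC xh p') ?(innerC b a)
  ?(innerC p a) ?(innerC p' a) ?(innerC q a)
  ?(innerC p b) ?(innerC p' b) ?(innerC q b) ?(innerC xh b)
  ?(innerC p c) ?(innerC p' c) ?(innerC q c) ?(innerC xh c).
move=> Ip' Ip Iq sq0 sq1 Iy acc; lra.
Qed.

(** * The two gaps as [g] and [fs] plus real affine functions, hence convex *)

Lemma PgapE xh yh v : g xh \is a fin_num ->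
  (Pgap Kstar g xh yh v = g v + ('<<Kstar yh, v - xh>> - fine (g xh))%:E)%E.
Proof.
by move=> /fineK gE; rewrite /Pgap -{1}gE -addeA -EFinN -EFinD (addrC (- fine _)).
Qed.

Lemma DgapE xh yh v : fs yh \is a fin_num ->
  (Dgap K fs xh yh v = fs v + (- '<<K xh, v - yh>> - fine (fs yh))%:E)%E.
Proof.
by move=> /fineK fE; rewrite /Dgap -{1}fE -addeA -!EFinN -EFinD (addrC (- fine _)).
Qed.

Lemma econvex_Pgap xh yh : g xh \is a fin_num -> econvex g ->
  econvex (Pgap Kstar g xh yh).
Proof.
move=> gE cg; under [Pgap _ _ _ _]funext => v do rewrite PgapE//.
apply: econvexD_affine => // u v t; rewrite !innerE; ring.
Qed.

Lemma econvex_Dgap xh yh : fs yh \is a fin_num -> econvex fs ->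
  econvex (Dgap K fs xh yh).
Proof.
move=> fE cf; under [Dgap _ _ _ _]funext => v do rewrite DgapE//.
apply: econvexD_affine => // u v t; rewrite !innerE; ring.
Qed.

(** * Properties of the iterates *)

Section Iterates.
Context (x : nat -> X) (y : nat -> Y) (tau theta : nat -> R) (xbar : nat -> X).
Hypothesis alg : pdal K Kstar g fs mu delta beta x y tau theta xbar.

Lemma pdal_tau_theta_gt0 k : 0 < tau k /\ 0 < theta k.
Proof.
elim: k => [|k [tk thk]].
  by rewrite (pdal_theta0 alg) (pdal_tau0 alg).
have [t /andP[t1 _]] := pdal_linesearch alg k.
move=> /(linesearchP (pdal_mu alg) (lt_le_trans tk t1)).
by move=> [/andP[tk' _] -> _ _ _]; rewrite divr_gt0.
Qed.

Let tau_gt0 k : 0 < tau k. Proof. by have [] := pdal_tau_theta_gt0 k. Qed.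
Let theta_gt0 k : 0 < theta k. Proof. by have [] := pdal_tau_theta_gt0 k. Qed.

(** The second bound is the square of [tau k.+1 <= tau k * Num.sqrt (1 + theta k)], divided by
    [tau k]; it later makes the averaging weights nonnegative. *)
Lemma pdal_linesearchP k :
  [/\ tau k.+1 = theta k.+1 * tau k,
      tau k.+1 * theta k.+1 <= tau k * (1 + theta k),
      xbar k.+1 = x k.+1 + theta k.+1 *: (x k.+1 - x k),
      ls_dual K fs beta (x k) (x k.+1) (y k.+1) (tau k) (tau k.+1) (y k.+2) &
      ls_accept Kstar delta beta (y k.+1) (tau k.+1) (y k.+2)].
Proof.
have [t /andP[t1 t2]] := pdal_linesearch alg k.
move=> /(linesearchP (pdal_mu alg) (lt_le_trans (tau_gt0 k) t1)).
move=> [/andP[tk' tt] thE -> d a]; split=> //.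
  by rewrite thE divfK// gt_eqF.
have : tau k.+1 ^+ 2 <= (tau k * Num.sqrt (1 + theta k)) ^+ 2.
  rewrite ler_pXn2r// ?nnegrE ?(ltW tk')//; first exact: le_trans tt t2.
  by rewrite mulr_ge0 ?sqrtr_ge0// ltW.
rewrite exprMn sqr_sqrtr; last by rewrite ltW// addr_gt0.
rewrite thE mulrA ler_pdivrMr// -expr2 => /le_trans; apply.
by rewrite expr2 mulrAC.
Qed.

Lemma pdal_dual k : prox (fun z => (beta * tau k.+1)%:E * fs z)%E
  (y k.+1 + (beta * tau k.+1) *: K (xbar k.+1)) (y k.+2).
Proof.
have [thE _ -> + _] := pdal_linesearchP k.
by rewrite thE /ls_dual /ls_xbar /ls_theta mulfK ?gt_eqF.
Qed.

Hypothesis (pg : proper_efun g) (cg : econvex g).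
Hypothesis (pf : proper_efun fs) (cf : econvex fs).

Lemma pdal_primal_fin k : g (x k.+1) \is a fin_num.
Proof. exact: prox_fin_num (tau_gt0 k) pg (pdal_primal alg k). Qed.

Lemma pdal_dual_fin k : fs (y k.+2) \is a fin_num.
Proof.
exact: prox_fin_num (mulr_gt0 (pdal_beta alg) (tau_gt0 _)) pf (pdal_dual k).
Qed.

(** Finiteness of [g (x k)] is a hypothesis because [x 0] is arbitrary; the later iterates are
    proximal points. *)
Lemma pdal_energy (xh : X) (yh : Y) k
    (P := fun v => fine (Pgap Kstar g xh yh v))
    (D := fun v => fine (Dgap K fs xh yh v))
    (E := fun k => 2^-1 * `|x k - xh| ^+ 2 + (2 * beta)^-1 * `|y k - yh| ^+ 2) :
  g xh \is a fin_num -> fs yh \is a fin_num -> g (x k) \is a fin_num ->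
  tau k.+1 * ((1 + theta k.+1) * P (x k.+1) - theta k.+1 * P (x k) + D (y k.+2))
  <= E k.+1 - E k.+2.
Proof.
move=> gxh fyh gxk; have [thE _ xbE _ acc] := pdal_linesearchP k.
have PE v : g v \is a fin_num ->
    P v = fine (g v) - fine (g xh) + '<<Kstar yh, v - xh>>.
  by move=> /fineK gv; rewrite /P PgapE// -gv -EFinD /= addrA addrAC.
have DE v : fs v \is a fin_num ->
    D v = fine (fs v) - fine (fs yh) - '<<K xh, v - yh>>.
  by move=> /fineK fv; rewrite /D DgapE// -fv -EFinD /= addrA addrAC.
have gk1 := pdal_primal_fin k; have gk2 := pdal_primal_fin k.+1.
rewrite !PE// DE ?pdal_dual_fin//.
(* Multiplying the inequality of the previous primal step by [theta k.+1] turns its step [tau k]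
   into [tau k.+1]. It is used at [x k.+2] and, scaled by [theta k.+1] once more, at [x k]. *)
have vk w : g w \is a fin_num -> tau k.+1 * (fine (g (x k.+1)) - fine (g w)) <=
    '<<theta k.+1 *: (x k.+1 - x k) + tau k.+1 *: Kstar (y k.+1), w - x k.+1>>.
  move=> gw; have := prox_variational (tau_gt0 k) pg cg (pdal_primal alg k) gw.
  move=> /(ler_wpM2l (ltW (theta_gt0 k.+1))); rewrite mulrA -thE => /le_trans; apply.
  by rewrite -innerZl opprB addrCA addrC scalerDr scalerA -thE.
have beta0 := pdal_beta alg.
apply: (energy_step (gp' := fine (g (x k.+2)))) => //.
- exact: prox_variational (tau_gt0 k.+1) pg cg (pdal_primal alg k.+1) gxh.
- exact: vk.
- have := vk _ gxk => /(ler_wpM2l (ltW (theta_gt0 k.+1))).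
  by rewrite innerZr mulrA (mulrC (theta _) (tau _)).
- have := pdal_dual k; rewrite xbE => yk.
  exact: prox_variational (mulr_gt0 beta0 (tau_gt0 _)) pf cf yk fyh.
(* The acceptance test is weakened by [delta < 1] and squared. *)
- have /andP[d0 d1] := pdal_delta alg.
  have {}acc := le_trans acc (ler_piMl (normr_ge0 _) (ltW d1)).
  have : (Num.sqrt beta * tau k.+1 * `|Kstar (y k.+2) - Kstar (y k.+1)|) ^+ 2
      <= `|y k.+2 - y k.+1| ^+ 2.
    rewrite ler_pXn2r// nnegrE//.
    by rewrite mulr_ge0// mulr_ge0 ?sqrtr_ge0// ltW.
  by rewrite !exprMn sqr_sqrtr ?(ltW beta0)// -mulrA.
Qed.

End Iterates.

End PrimalDualLinesearch.

(* With [t k = tau k.+1] and [w k = tau k.+1 * theta k.+1] the right-hand sum is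
   the one of the [tau k.+1 *: xbar k.+1]. *)
Lemma sum_shifted_weights (R : pzRingType) (V : lmodType R) (t w : nat -> R)
    (u : nat -> V) (n : nat) :
  \sum_(0 <= k < n) (t k + w k - w k.+1) *: u k.+1 =
  w 0%N *: u 0%N
  + \sum_(0 <= k < n) (t k *: u k.+1 + w k *: (u k.+1 - u k)) - w n *: u n.
Proof.
elim: n => [|n IH]; first by rewrite !big_geq// addr0 subrr.
rewrite !big_nat_recr//= IH !scalerDl scalerBr scaleNr.
rewrite !addrA; congr (_ - _).
rewrite -!addrA; congr (_ + (_ + _)).
by rewrite addrC -!addrA.
Qed.

(** * Summation and the ergodic gap bound *)

Unset Implicit Arguments.

Theorem theorem2 (R : realType) (X Y : euclideanType R)
    (K : {linear X -> Y}) (Kstar : {linear Y -> X})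
    (g : X -> \bar R) (f : Y -> \bar R)
    (mu delta beta : R)
    (x : nat -> X) (y : nat -> Y) (tau theta : nat -> R) (xbar : nat -> X)
    (xh : X) (yh : Y) (N : nat) :
  adjoint K Kstar ->
  proper_efun g -> lower_semicontinuous g -> econvex g ->
  lower_semicontinuous f -> econvex f ->
  proper_efun (conjugate f) -> lower_semicontinuous (conjugate f) ->
  econvex (conjugate f) ->
  pdal K Kstar g (conjugate f) mu delta beta x y tau theta xbar ->
  saddle_point K Kstar g (conjugate f) xh yh ->
  (1 <= N)%N ->
  (pdgap K Kstar g (conjugate f) xh yh (x_avg x tau theta xbar N) (y_avg y tau N)
   <= ((tau_sum tau N)^-1)%:E *
      ((2^-1 * `|x 1%N - xh| ^+ 2 + (2 * beta)^-1 * `|y 1%N - yh| ^+ 2)%:E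
       + (tau 1%N * theta 1%N)%:E * Pgap Kstar g xh yh (x 0%N)))%E.
Proof.
move=> KK pg _ cg _ _ pf _ cf alg [dxh dyh Pge0 _] N0.
move: (conjugate f) pf cf alg dyh => fs pf cf alg dyh.
have gxh := fin_num_proper_dom pg dxh.
have fyh := fin_num_proper_dom pf dyh.
have tau0 k : 0 < tau k by have [] := pdal_tau_theta_gt0 alg k.
have theta0 k : 0 < theta k by have [] := pdal_tau_theta_gt0 alg k.
have s0 : 0 < tau_sum tau N.
  rewrite /tau_sum; case: N N0 => // n _; rewrite big_nat_recr//=.
  by rewrite ltr_wpDl// sumr_ge0// => k _; exact: ltW.
have [gx0|gx0] := boolP (g (x 0%N) \is a fin_num); last first.
  have {}gx0 : g (x 0%N) = +oo%E.
    apply/eqP; move: gx0; rewrite fin_numE negb_and !negbK => /orP[|//].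
    by move=> /eqP h; case: pg => /(_ (x 0%N)); rewrite h.
  have -> : Pgap Kstar g xh yh (x 0%N) = +oo%E by rewrite PgapE// gx0 addye.
  rewrite gt0_muley ?lte_fin ?mulr_gt0// addey// gt0_muley ?leey//.
  by rewrite lte_fin invr_gt0.
have gfin k : g (x k) \is a fin_num.
  by case: k => [//|k]; exact: pdal_primal_fin alg pg k.
have ffin k : fs (y k.+2) \is a fin_num.
  exact: pdal_dual_fin alg pf k.
set P := fun v => fine (Pgap Kstar g xh yh v).
set D := fun v => fine (Dgap K fs xh yh v).
have PE k : Pgap Kstar g xh yh (x k) = (P (x k))%:E.
  by rewrite fineK// PgapE// fin_numD gfin.
have DE k : Dgap K fs xh yh (y k.+2) = (D (y k.+2))%:E.
  by rewrite fineK// DgapE// fin_numD ffin.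
have P0 k : 0 <= P (x k) by rewrite -lee_fin -PE.
(* Cutting [w] off at [N] removes the boundary term of the summation by parts and leaves the last
   point [x N] its full weight [tau N * (1 + theta N)]. Here [c k] is the weight of [x k.+1]. *)
pose w k := if (k < N)%N then tau k.+1 * theta k.+1 else 0.
pose c k := tau k.+1 + w k - w k.+1.
have w0 : w 0%N = tau 1%N * theta 1%N by rewrite /w N0.
have wN : w N = 0 by rewrite /w ltnn.
have c0 k : 0 <= c k.
  rewrite /c /w; case: ifPn => kN; case: ifPn => kN1.
  - have [_ + _ _ _] := pdal_linesearchP alg k.+1.
    lra.
  - by rewrite subr0 addr_ge0 ?mulr_ge0 ?ltW.
  - by rewrite (ltn_trans _ kN1) in kN.
  - by rewrite addr0 subr0 ltW.
have sE : tau_sum tau N = \sum_(0 <= k < N) tau k.+1.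
  by rewrite /tau_sum big_add1.
have cE : \sum_(0 <= k < N) c k = w 0%N + tau_sum tau N.
  (* The constant sequence 1 turns the identity into the total weight. *)
  have := sum_shifted_weights (V := R^o) (fun k => tau k.+1) w (fun=> 1) N.
  rewrite wN scale0r subr0 sE; under eq_bigr do rewrite [_ *: _]mulr1.
  move=> ->; rewrite [_ *: _]mulr1; congr (_ + _); apply: eq_bigr => k _.
  by rewrite subrr scaler0 addr0 [_ *: _]mulr1.
have xE : x_avg x tau theta xbar N =
    (\sum_(0 <= k < N) c k)^-1 *: \sum_(0 <= k < N) c k *: x k.+1.
  rewrite cE sum_shifted_weights wN scale0r subr0 w0 /x_avg; congr (_ *: (_ + _)).
  rewrite big_add1; apply: eq_big_nat => k /andP[_ kN].
  have [_ _ -> _ _] := pdal_linesearchP alg k.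
  by rewrite /w kN scalerDr scalerA.
have wN0 : 0 < w 0%N by rewrite w0 mulr_gt0.
set A := \sum_(0 <= k < N) c k * P (x k.+1).
set B := \sum_(0 <= k < N) tau k.+1 * D (y k.+2).
have A0 : 0 <= A by apply: sumr_ge0 => k _; rewrite mulr_ge0.
have PX : (Pgap Kstar g xh yh (x_avg x tau theta xbar N) <=
    ((tau_sum tau N)^-1 * A)%:E)%E.
  rewrite xE; apply: (@le_trans _ _ ((\sum_(0 <= k < N) c k)^-1 * A)%:E).
    apply: jensen => //; first exact: econvex_Pgap.
      by move=> k; rewrite PE.
    by rewrite cE addr_gt0.
  (* Since [A >= 0], by the saddle-point inequality for [P], the normalisation can be relaxed from
     [w 0 + tau_sum tau N] to [tau_sum tau N]. *)
  rewrite lee_fin ler_wpM2r// lef_pV2 ?posrE ?cE ?addr_gt0//.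
  by rewrite lerDr ltW.
have DY : (Dgap K fs xh yh (y_avg y tau N) <= ((tau_sum tau N)^-1 * B)%:E)%E.
  rewrite /y_avg big_add1 sE; apply: jensen; first exact: econvex_Dgap.
  - by move=> k; exact: ltW.
  - by move=> k; rewrite DE.
  - by rewrite -sE.
apply: (le_trans (leeD PX DY)).
rewrite PE -EFinM -!EFinD lee_fin -mulrDr ler_pM2l ?invr_gt0//.
pose E k := 2^-1 * `|x k - xh| ^+ 2 + (2 * beta)^-1 * `|y k - yh| ^+ 2.
have beta0 := pdal_beta alg.
have EN : 0 <= E N.+1.
  by rewrite addr_ge0// mulr_ge0 ?sqr_ge0// invr_ge0 ?mulr_ge0 ?ltW.
have -> : A = w 0%N * P (x 0%N) + \sum_(0 <= k < N)
    (tau k.+1 * P (x k.+1) + w k * (P (x k.+1) - P (x k))).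
  (* The same summation by parts, now applied to the values [P (x k)]. *)
  have := sum_shifted_weights (V := R^o) (fun k => tau k.+1) w (fun k => P (x k)) N.
  by rewrite wN scale0r subr0.
rewrite -addrA addrC w0 lerD2r -big_split /=.
(* The energy differences telescope to [E 1 - E N.+1], and [E N.+1 >= 0] is discarded. *)
apply: (@le_trans _ _ (\sum_(0 <= k < N) (E k.+1 - E k.+2))); last first.
  rewrite (telescope_sumr_eq (fun k => - E k.+1))//.
    by rewrite opprK addrC gerBl.
  by move=> k _; rewrite opprK addrC.
rewrite !big_nat; apply: ler_sum => k /andP[_ kN].
apply: le_trans (pdal_energy KK alg pg cg pf cf gxh fyh (gfin k)).
rewrite /w kN -/(P _) -/(D _) -/(P _).
by lra.
Qed.
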